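(* Let $G$ be a planar graph on $n\ge 2$ vertices that admits an interval colouring. Then $t(G)\le \frac{3}{2}n-2$.
   Context: An interval colouring of a graph $G$ is a proper edge-colouring $c\colon E(G)\to\mathbb{N}$ such that for every vertex $v$, the set of colours on edges incident to $v$ is a set of consecutive integers. For an interval colourable graph $G$, $t(G)$ denotes the greatest number of distinct colours used in an interval colouring of $G$. *)

(* Defs.v *)
From Stdlib Require Import Reals.
From mathcomp Require Import all_boot.

Set Implicit Arguments.
Unset Strict Implicit.
Unset Printing Implicit Defensive.

Definition simple_graph (T : finType) (e : rel T) : Prop :=
  symmetric e /\ irreflexive e.

Definition edges (T : finType) (e : rel T) : {set {set T}} :=
  [set f : {set T} | [exists x, exists y, e x y && (f == [set x; y])]].

Definition proper_edge_colouring (T : finType) (e : rel T)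
    (c : {set T} -> nat) : Prop :=
  forall f1 f2, f1 \in edges e -> f2 \in edges e -> f1 != f2 ->
    ~~ [disjoint f1 & f2] -> c f1 != c f2.

Definition colour_at (T : finType) (e : rel T) (c : {set T} -> nat)
    (v : T) (k : nat) : Prop :=
  exists2 f, f \in edges e & (v \in f) && (c f == k).

Definition interval_colouring (T : finType) (e : rel T)
    (c : {set T} -> nat) : Prop :=
  proper_edge_colouring e c /\
  forall v a b k, colour_at e c v a -> colour_at e c v b ->
    a <= k <= b -> colour_at e c v k.

Definition num_colours (T : finType) (e : rel T) (c : {set T} -> nat) : nat :=
  size (undup [seq c f | f <- enum (edges e)]).

(* Planarity: a drawing in R^2 with vertices as distinct points and edges as
   Jordan arcs (continuous, injective on [0,1]) joining their endpoints, whose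
   interiors avoid all vertex points and the interiors of all other edges.
   Arcs are given for ordered pairs (x,y) with e x y; arcs of the same
   unordered edge are not compared. Paths are defined on all of R (any
   continuous map on [0,1] extends continuously to R). *)
Definition planar (T : finType) (e : rel T) : Prop :=
  exists (pos : T -> (R * R)%type) (arc : T -> T -> R -> (R * R)%type),
    injective pos /\
    (forall x y, e x y ->
       [/\ arc x y R0 = pos x, arc x y R1 = pos y,
           continuity (fun t => fst (arc x y t)) /\
             continuity (fun t => snd (arc x y t)),
           (forall t s, (Rle R0 t /\ Rle t R1) -> (Rle R0 s /\ Rle s R1) ->
              arc x y t = arc x y s -> t = s) &
           (forall t z, (Rlt R0 t /\ Rlt t R1) -> arc x y t <> pos z)]) /\
    (forall x y x' y', e x y -> e x' y' ->
       ~ ((x' = x /\ y' = y) \/ (x' = y /\ y' = x)) ->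
       forall t s, (Rlt R0 t /\ Rlt t R1) -> (Rlt R0 s /\ Rlt s R1) ->
         arc x y t <> arc x' y' s).

(* Main.v *)
Require Import Defs.
From Stdlib Require Import Reals Lra Ring ClassicalEpsilon.
From mathcomp Require Import all_boot zify.
From Coquelicot Require Import Compactness.

(** If some colour [k], neither the least nor the greatest, is used on a single
    edge [uv], then every vertex meeting colours on both sides of [k] meets [k],
    so the edges of colour at most [k] and those of colour at least [k] share
    only the vertices [u] and [v]; the bound for the two parts gives the bound
    for the whole.  Otherwise all colours but two occur at least twice, so
    [2 t - 2 <= m], and it remains to know [m <= 3 n - 6].

    For the latter, call a graph drawable if its edges can be drawn so that
    vertex-disjoint edges have disjoint images; nothing is asked of adjacent
    edges, which makes the class closed under contraction.  In a minimal
    drawable graph with [m > 3 n - 6] every edge lies in three triangles and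
    some vertex has degree at most five, which yields a K5 minor (Mader).
    Finally K5 is not drawable, by counting modulo two the crossings of
    vertex-disjoint edges.  Drawings are represented by finite samples of the
    arcs, of mesh [d], with samples of disjoint edges more than [2 d] apart, so
    that above and below can be decided by comparing ordinates. *)

Set Implicit Arguments.
Unset Strict Implicit.
Unset Printing Implicit Defensive.

(* The MathComp imports rebind the key [R] to [ring_scope]. *)
Delimit Scope R_scope with R.
Local Open Scope nat_scope.

(** * Parity of crossings *)

Notation point := (R * R)%type.

Definition Rltb (x y : R) : bool := if Rlt_dec x y then true else false.

Lemma RltbP x y : reflect (Rlt x y) (Rltb x y).
Proof. by rewrite /Rltb; case: Rlt_dec => H; constructor. Qed.

(** Breaking ties by ordinate tilts the vertical rays slightly: distinct points never share one, and
    the order is a tournament on them. *)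
Definition lex (p q : point) : bool :=
  Rltb p.1 q.1 || ~~ Rltb q.1 p.1 && Rltb p.2 q.2.

Definition near (d : R) (p q : point) : bool :=
  Rltb (Rabs (p.1 - q.1)) d && Rltb (Rabs (p.2 - q.2)) d.

(** The factor 2 lets both points move by a step of less than [d] without changing the sign of the
    separating coordinate difference. *)
Definition far (d : R) (p q : point) : bool :=
  Rltb (2 * d) (Rabs (p.1 - q.1)) || Rltb (2 * d) (Rabs (p.2 - q.2)).

(* Parity of the number of segments met by the downward ray from [p].  Whether
   a segment lies below [p] is read off its first point only, which is correct
   when the mesh is small compared with the distance to [p]. *)
Fixpoint crossings_below (p a : point) (s : seq point) : bool :=
  if s is b :: s' then
    xorb (xorb (lex a p) (lex b p) && Rltb a.2 p.2) (crossings_below p b s')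
  else false.

(** Some coordinate separates [a] from [p] by more than [2 d], with a sign shared by all four pairs.
    If it is the first one, or if [a] is above [p], every term vanishes; if [a] is below [p], the
    sum pairs [lex] with its converse four times, giving four ones. *)
Lemma segment_parity d a b p q :
  near d a b -> near d p q ->
  far d a p -> far d a q -> far d b p -> far d b q ->
  xorb (xorb (xorb (lex a p) (lex b p) && Rltb a.2 p.2)
             (xorb (lex a q) (lex b q) && Rltb a.2 q.2))
       (xorb (xorb (lex p a) (lex q a) && ~~ Rltb p.2 a.2)
             (xorb (lex p b) (lex q b) && ~~ Rltb p.2 b.2)) = false.
Proof.
case: a => ax ay; case: b => bx yb; case: p => px py; case: q => qx qy.
rewrite /near /far /lex /=.
move=> /andP[/RltbP/Rabs_def2[h1 h2] /RltbP/Rabs_def2[h3 h4]].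
move=> /andP[/RltbP/Rabs_def2[h5 h6] /RltbP/Rabs_def2[h7 h8]].
move=> /orP F _ _ _.
have {}F : ([\/ ax + 2 * d < px, px + 2 * d < ax,
    ay + 2 * d < py | py + 2 * d < ay])%R.
  case: F => /RltbP; rewrite /Rabs; case: Rcase_abs => _ H;
  by [constructor 1; lra | constructor 2; lra | constructor 3; lra |
      constructor 4; lra].
have lt x y : (x < y)%R -> Rltb x y = true by move/RltbP.
have nlt x y : (y < x)%R -> Rltb x y = false.
  by move=> ?; apply/RltbP; lra.
case: F => F.
- by rewrite !(lt ax, lt bx) //; try lra; rewrite !(nlt px, nlt qx) //; lra.
- by rewrite !(nlt ax, nlt bx) //; try lra; rewrite !(lt px, lt qx) //; lra.
- rewrite (lt ay py) ?(lt ay qy) ?(lt yb py) ?(lt yb qy)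
    ?(nlt py ay) ?(nlt qy ay) ?(nlt py yb) ?(nlt qy yb) ?andbT ?andbF //; try lra.
  by case: (RltbP ax px); case: (RltbP px ax); case: (RltbP ax qx); case: (RltbP qx ax);
     case: (RltbP bx px); case: (RltbP px bx); case: (RltbP bx qx); case: (RltbP qx bx);
     move=> * //; lra.
- by rewrite (nlt ay py) ?(nlt ay qy) ?(lt py ay) ?(lt py yb) ?andbF //; lra.
Qed.

Lemma xorb_eq_false x y z : x = false -> y = false -> z = xorb x y -> z = false.
Proof. by move=> -> ->. Qed.

(* The left-hand side counts the crossings of the two polygonal paths modulo
   two: it is additive in each path, and telescopes to endpoint terms. *)
Lemma far_paths_parity d a s p r :
  path (near d) a s -> path (near d) p r -> allrel (far d) (a :: s) (p :: r) ->
  xorb (xorb (xorb (crossings_below p a s) (crossings_below (last p r) a s))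
             (xorb (crossings_below a p r) (crossings_below (last a s) p r)))
       (xorb (xorb (lex p a) (lex (last p r) a))
             (xorb (lex p (last a s)) (lex (last p r) (last a s)))) = false.
Proof.
elim: s a => [|b s IHs] a /=; first by move=> *; ring.
move=> /andP[ab Ps] Pr; rewrite allrel_consl => /andP[Fa Fs].
have:= IHs b Ps Pr Fs.
have: allrel (far d) [:: a; b] (p :: r).
  by move: Fs; rewrite !allrel_consl Fa => /andP[-> _].
move: Pr {IHs Ps Fa Fs} => Pr Fr.
(* One segment [a b] against the whole second path; a second induction reduces this to
   [segment_parity]. *)
suff : xorb (xorb (xorb (lex a p) (lex b p) && Rltb a.2 p.2)
             (xorb (lex a (last p r)) (lex b (last p r)) && Rltb a.2 (last p r).2))
       (xorb (xorb (crossings_below a p r) (crossings_below b p r))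
       (xorb (xorb (lex p a) (lex (last p r) a))
             (xorb (lex p b) (lex (last p r) b)))) = false.
  by move=> H1 H2; apply: (xorb_eq_false H1 H2) => /=; ring.
elim: r p Pr Fr => [|q r IHr] p /=; first by move=> *; ring.
case/andP=> pq Pr Fr.
have Fr' : allrel (far d) [:: a; b] (q :: r).
  by move: Fr; rewrite !allrel_consr => /andP[_].
have /= := IHr q Pr Fr'.
have /= : xorb (xorb (xorb (lex a p) (lex b p) && Rltb a.2 p.2)
             (xorb (lex a q) (lex b q) && Rltb a.2 q.2))
       (xorb (xorb (lex p a) (lex q a) && ~~ Rltb p.2 a.2)
             (xorb (lex p b) (lex q b) && ~~ Rltb p.2 b.2)) = false.
  move: Fr; rewrite !allrel_consr /= => /and3P[/and3P[? ? _] /and3P[? ? _] _].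
  exact: (@segment_parity d).
(* Each negation adds a one, which turns a term into a [crossings_below] summand plus [lex] terms
   that telescope. *)
have nE x : ~~ x = xorb true x by case: x.
by rewrite !nE => H1 H2; apply: (xorb_eq_false H1 H2); ring.
Qed.

(** * Sampled drawings, contraction and K5 *)

(** The list [arc x y] omits the starting point [pos x], so that arcs are glued by plain
    concatenation. *)
Definition drawing (T : finType) (e : rel T) (d : R) (pos : T -> point)
    (arc : T -> T -> seq point) : Prop :=
  [/\ (0 < d)%R,
   forall x y, e x y ->
     path (near d) (pos x) (arc x y) /\ last (pos x) (arc x y) = pos y &
   forall x y z w, e x y -> e z w -> uniq [:: x; y; z; w] ->
     allrel (far d) (pos x :: arc x y) (pos z :: arc z w)].

Definition drawable (T : finType) (e : rel T) : Prop :=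
  exists d pos arc, drawing e d pos arc.

Lemma sub_drawable (T : finType) (e e' : rel T) :
  subrel e' e -> drawable e -> drawable e'.
Proof.
move=> sub [d [pos [arc [d0 He Hd]]]]; exists d, pos, arc; split=> // [x y /sub|].
  exact: He.
by move=> x y z w /sub xy /sub; apply: Hd.
Qed.

(** The vertex [y] is merged into [x] but stays in the type as an isolated vertex, so no quotient is
    formed. *)
Definition contract (T : finType) (e : rel T) (x y : T) : rel T := fun u v =>
  [&& u != y, v != y & [|| e u v, [&& u == x, v != x & e y v] |
                           [&& v == x, u != x & e u y]]].

(** A new edge follows two old arcs through [y]. Of two disjoint edges at most one contains [x], so
    at most one route passes through [y], and the routes consist of old arcs with disjoint ends. *)
Lemma contract_drawable (T : finType) (e : rel T) (x y : T) :
  symmetric e -> irreflexive e -> e x y -> drawable e -> drawable (contract e x y).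
Proof.
move=> sym irr xy [d [pos [arc [d0 He Hd]]]].
have yx : e y x by rewrite sym.
pose arc' u v := if e u v then arc u v else
  if u == x then arc x y ++ arc y v else arc u y ++ arc y x.
exists d, pos, arc'; split=> // [u v|].
  rewrite /contract /arc' => /and3P[_ _]; case: ifP => [/He//|_] /=.
  have glue a b c : e a b -> e b c -> path (near d) (pos a) (arc a b ++ arc b c) /\
      last (pos a) (arc a b ++ arc b c) = pos c.
    by move=> /He[Pab Lab] /He[Pbc Lbc]; rewrite cat_path last_cat Lab Pab Pbc.
  by case/orP=> /and3P[/eqP-> nx ?]; rewrite ?eqxx ?(negPf nx); apply: glue.
have farC p q : far d p q = far d q p.
  by rewrite /far !(Rabs_minus_sym p.1) !(Rabs_minus_sym p.2).
have allrelC s1 s2 : allrel (far d) s1 s2 = allrel (far d) s2 s1.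
  by rewrite allrelC; apply: eq_allrel => a b; apply: farC.
(* The old vertices that the route of [u v] may visit. *)
pose used u v a := (a \in [:: u; v]) || (a == y) && ((u == x) || (v == x)).
suff main : forall u v (r : seq point), contract e x y u v ->
    (forall a b, e a b -> used u v a -> used u v b ->
       allrel (far d) (pos a :: arc a b) r) ->
    allrel (far d) (pos u :: arc' u v) r.
  move=> u v z w uv zw Hu; apply: (main) (uv) _ => a b ab Ha Hb.
  rewrite allrelC; apply: (main) (zw) _ => a' b' ab' Ha' Hb'.
  rewrite allrelC; apply: Hd => //.
  have disj c c' : used u v c -> used z w c' -> c != c'.
    case/and3P: uv zw Hu => /negPf uy /negPf vy _ /and3P[/negPf zy /negPf wy _].
    rewrite /used /= !inE !negb_or -!andbA => /and5P[_ uz uw vz /and3P[vw _ _]].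
    move=> Hc Hc'; apply/eqP => cc'; subst c'; move: Hc Hc'.
    case: (eqVneq c y) => [->|_] /=; rewrite ?orbF.
      rewrite !(eq_sym y) uy vy zy wy /=.
      case/orP=> /eqP E; rewrite -E; first by rewrite !(eq_sym _ u) (negPf uz) (negPf uw).
      by rewrite !(eq_sym _ v) (negPf vz) (negPf vw).
    case/orP=> /eqP->; first by rewrite (negPf uz) (negPf uw).
    by rewrite (negPf vz) (negPf vw).
  have ne c c' : e c c' -> c != c' by apply: contraTneq => ->; rewrite irr.
  by rewrite /= !inE !negb_or (ne _ _ ab) (ne _ _ ab') !disj.
move=> u v r /and3P[nuy nvy]; rewrite /arc'; case: ifP => [uv _|_ /= H] Hr.
  by apply: Hr; rewrite // /used !inE eqxx ?orbT.
have glue a b c : e a b -> e b c -> allrel (far d) (pos a :: arc a b) r ->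
   allrel (far d) (pos b :: arc b c) r -> allrel (far d) (pos a :: arc a b ++ arc b c) r.
  rewrite -cat_cons allrel_catl => _ _ -> /=.
  by rewrite allrel_consl => /andP[].
by case/orP: H => /and3P[/eqP E nx ?]; subst; rewrite ?eqxx ?(negPf nx);
  apply: glue => //; apply: Hr; rewrite // /used !inE ?eqxx ?orbT.
Qed.

(* Summing the parities over the fifteen pairs of disjoint edges, every term
   [crossings_below] occurs twice, and the terms [lex] add up to one because
   [lex] is a tournament on the five vertices. *)
Lemma drawable_no_K5 (T : finType) (e : rel T) (v : 5.-tuple T) :
  drawable e -> uniq v -> (forall i j : 'I_5, i != j -> e (tnth v i) (tnth v j)) -> False.
Proof.
move=> [d [pos [arc [d0 He Hd]]]] Uv Hv.
case: v Uv Hv => -[|v0 [|v1 [|v2 [|v3 [|v4 [|]]]]]] //= sz Uv Hv.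
pose x i := nth v0 [:: v0; v1; v2; v3; v4] i.
have ex i j : i < 5 -> j < 5 -> i != j -> e (x i) (x j).
  move=> i5 j5 ij.
  by have := Hv (Ordinal i5) (Ordinal j5) ij; rewrite !(tnth_nth v0).
have ux i j : i < 5 -> j < 5 -> i != j -> x i != x j.
  by move=> i5 j5; apply: contra; rewrite nth_uniq.
pose L i j := lex (pos (x i)) (pos (x j)).
pose U k i j := crossings_below (pos (x k)) (pos (x i)) (arc (x i) (x j)).
pose dis i j k l := all (gtn 5) [:: i; j; k; l] && uniq [:: i; j; k; l].
have rel i j k l : dis i j k l ->
    [/\ e (x i) (x j), e (x k) (x l) & uniq [:: x i; x j; x k; x l]].
  rewrite /dis /= !inE !negb_or -!andbA => /and5P[i5 j5 k5 l5 /and5P[_ ij ik il]].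
  by case/and4P=> jk jl kl _; split; rewrite ?ex //= !ux.
have eqn i j k l : dis i j k l ->
    xorb (xorb (xorb (U k i j) (U l i j)) (xorb (U i k l) (U j k l)))
         (xorb (xorb (L k i) (L l i)) (xorb (L k j) (L l j))) = false.
  case/rel=> xij xkl uxs; have [Pij Lij] := He _ _ xij.
  have [Pkl Lkl] := He _ _ xkl.
  by have /= := @far_paths_parity d _ _ _ _ Pij Pkl (Hd _ _ _ _ xij xkl uxs);
     rewrite Lij Lkl.
(* A drawing separates only disjoint edges; the partners [k] and [l] supply such edges at [i] and
   [j], whence distinct positions. *)
have LC i j k l : dis i k j l -> L j i = xorb true (L i j).
  case/rel=> xik xjl uxs; have := Hd _ _ _ _ xik xjl uxs.
  rewrite allrel_consl /= -andbA => /and3P[+ _ _]; rewrite /far /L /lex.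
  case: (pos (x i)) (pos (x j)) => [a b] [a' b'] /= H.
  have : a <> a' \/ b <> b'.
    by case/orP: H => /RltbP H; [left|right] => E; move: H;
      rewrite E /Rminus Rplus_opp_r Rabs_R0; lra.
  case: (RltbP a a'); case: (RltbP a' a); case: (RltbP b b'); case: (RltbP b' b) => //=;
    by move=> *; lra.
have [E1 E2 E3] : [/\ L 1 0 = xorb true (L 0 1), L 2 0 = xorb true (L 0 2) &
    L 3 0 = xorb true (L 0 3)].
  by rewrite (LC 0 1 2 3) // (LC 0 2 1 3) // (LC 0 3 1 2).
have [E4 E5 E6] : [/\ L 4 0 = xorb true (L 0 4), L 2 1 = xorb true (L 1 2) &
    L 3 1 = xorb true (L 1 3)].
  by rewrite (LC 0 4 1 2) // (LC 1 2 0 3) // (LC 1 3 0 2).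
have [E7 E8 E9 E10] : [/\ L 4 1 = xorb true (L 1 4), L 3 2 = xorb true (L 2 3),
     L 4 2 = xorb true (L 2 4) & L 4 3 = xorb true (L 3 4)].
  by rewrite (LC 1 4 0 2) // (LC 2 3 0 1) // (LC 2 4 0 1) // (LC 3 4 0 1).
have add a b : a = false -> b = false -> xorb a b = false by move=> -> ->.
(* The three splittings of four vertices into two disjoint edges; the five choices of four vertices
   yield all fifteen pairs. *)
have four a b c f : dis a b c f -> dis a c b f -> dis a f b c -> _ :=
  fun h1 h2 h3 => add _ _ (eqn a b c f h1) (add _ _ (eqn a c b f h2) (eqn a f b c h3)).
have := add _ _ (four 0 1 2 3 isT isT isT) (add _ _ (four 0 1 2 4 isT isT isT)
  (add _ _ (four 0 1 3 4 isT isT isT) (add _ _ (four 0 2 3 4 isT isT isT)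
  (four 1 2 3 4 isT isT isT)))).
rewrite !(E1, E2, E3, E4, E5, E6, E7, E8, E9, E10); set lhs := (X in X = false).
by have -> : lhs = true by rewrite /lhs; ring.
Qed.

(** * Sampling a planar drawing *)

Definition continuous_path (f : R -> point) : Prop :=
  continuity (fun t => fst (f t)) /\ continuity (fun t => snd (f t)).

Lemma continuity_modulus (f : R -> R) (t eps : R) :
  continuity f -> (0 < eps)%R ->
  exists2 d : R, (0 < d)%R &
    forall s, (Rabs (s - t) < d)%R -> (Rabs (f s - f t) < eps)%R.
Proof.
move=> cf e0; have [d [d0 Hd]] := cf t eps e0.
exists d => // s sd; case: (Req_dec s t) => [->|nst].
  by rewrite /Rminus Rplus_opp_r Rabs_R0.
by apply: Hd; split=> //; split=> // /esym.
Qed.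

(** Compactness of the unit square: each parameter pair has a radius [d] within which the paths stay
    [2 d] apart, and a uniform [d] is extracted from these. *)
Lemma disjoint_paths_separated (f g : R -> point) :
  continuous_path f -> continuous_path g ->
  (forall t s, (0 <= t <= 1)%R -> (0 <= s <= 1)%R -> f t <> g s) ->
  exists2 d, (0 < d)%R &
    forall t s, (0 <= t <= 1)%R -> (0 <= s <= 1)%R -> far d (f t) (g s).
Proof.
move=> [f1 f2] [g1 g2] fg.
have loc t s : exists d : posreal, (0 <= t <= 1)%R -> (0 <= s <= 1)%R ->
    forall t' s', (Rabs (t' - t) < d)%R -> (Rabs (s' - s) < d)%R ->
      (2 * d < Rabs ((f t').1 - (g s').1) \/ 2 * d < Rabs ((f t').2 - (g s').2))%R.
  case: (excluded_middle_informative (f t = g s)) => [E|nE].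
    by exists (mkposreal 1 Rlt_0_1) => t1 s1; case: (fg t s t1 s1).
  have [h [h0 Hh]] : exists h, (0 < h)%R /\
      (h <= Rabs ((f t).1 - (g s).1) \/ h <= Rabs ((f t).2 - (g s).2))%R.
    case: (Req_dec (f t).1 (g s).1) => [E1|n1]; last first.
      by exists (Rabs ((f t).1 - (g s).1)); split; [apply: Rabs_pos_lt; lra | left; lra].
    exists (Rabs ((f t).2 - (g s).2)); split; [apply: Rabs_pos_lt | right; lra].
    by move=> E2; apply: nE; case: (f t) (g s) E1 E2 => [a b] [a' b'] /= -> ?;
      congr (_, _); lra.
  have h4 : (0 < h / 4)%R by lra.
  have [d1 d10 H1] := continuity_modulus t f1 h4.
  have [d2 d20 H2] := continuity_modulus t f2 h4.
  have [d3 d30 H3] := continuity_modulus s g1 h4.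
  have [d4 d40 H4] := continuity_modulus s g2 h4.
  (* A gap of at least [h] shrinks by less than [h / 4] on each side, so more than [h / 2] remains,
     while [2 d] is at most [h / 4]. *)
  pose d := Rmin (h / 8) (Rmin (Rmin d1 d2) (Rmin d3 d4)).
  have d0 : (0 < d)%R by rewrite /d; repeat apply: Rmin_pos; lra.
  exists (mkposreal d d0) => _ _ t' s' /= Ht Hs.
  have [? l1 l2 l3 l4] : [/\ d <= h / 8, d <= d1, d <= d2, d <= d3 & d <= d4]%R.
    by rewrite /d /Rmin; do !case: Rle_dec; move=> *; split; lra.
  have /Rabs_def2 ? := H1 t' (Rlt_le_trans _ _ _ Ht l1).
  have /Rabs_def2 ? := H2 t' (Rlt_le_trans _ _ _ Ht l2).
  have /Rabs_def2 ? := H3 s' (Rlt_le_trans _ _ _ Hs l3).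
  have /Rabs_def2 ? := H4 s' (Rlt_le_trans _ _ _ Hs l4).
  by case: Hh; rewrite /Rabs; do !case: Rcase_abs; move=> *; lra.
pose delta t s := proj1_sig (constructive_indefinite_description _ (loc t s)).
have [d Hd] := compactness_value_2d 0 1 0 1 delta.
exists d; first exact: cond_pos.
move=> t s t1 s1; apply: NNPP => Hfar; apply: (Hd t s t1 s1).
case=> [u [v [u1 [v1 [tu [sv le]]]]]]; apply: Hfar.
move: tu sv le; rewrite /delta; case: constructive_indefinite_description => d' /= H tu sv le.
apply/orP; case: (H u1 v1 t s tu sv) => ?; [left|right]; apply/RltbP; lra.
Qed.

Lemma finite_common_bound (I : finType) (P : I -> R -> Prop) :
  (forall i d d', P i d -> (0 < d' <= d)%R -> P i d') ->
  (forall i, exists2 d, (0 < d)%R & P i d) ->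
  exists2 d, (0 < d)%R & forall i, P i d.
Proof.
move=> mono ex.
suff [d d0 Hd] : exists2 d, (0 < d)%R & forall i, i \in enum I -> P i d.
  by exists d => // i; apply: Hd; rewrite mem_enum.
elim: (enum I) => [|i s [d d0 IH]]; first by exists 1%R => //; lra.
have [d' d'0 Hi] := ex i.
have m0 := Rmin_pos _ _ d0 d'0.
exists (Rmin d d') => // j; rewrite inE => /predU1P[->|/IH Hj].
  by apply: mono Hi _; split=> //; apply: Rmin_r.
by apply: mono Hj _; split=> //; apply: Rmin_l.
Qed.

Lemma sample_parameter_bounds m i : i <= m.+1 -> (0 <= INR i / INR m.+1 <= 1)%R.
Proof.
move=> /leP/le_INR le.
have N0 : (0 < INR m.+1)%R by apply: lt_0_INR; lia.
have i0 := pos_INR i; split.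
  by apply: Rmult_le_pos => //; apply/Rlt_le/Rinv_0_lt_compat.
by apply: (Rmult_le_reg_r (INR m.+1)) => //; rewrite /Rdiv Rmult_assoc Rinv_l; lra.
Qed.

(** Uniform continuity on the unit interval gives the mesh. Indices start at 1 because a sampled arc
    omits its starting point. *)
Lemma path_sampling (f : R -> point) (d : R) :
  continuous_path f -> (0 < d)%R ->
  exists n, path (near d) (f 0%R) [seq f (INR i / INR n.+1)%R | i <- iota 1 n.+1].
Proof.
move=> [f1 f2] d0.
have c01 := compact_P3 0 1.
have [d1 H1] := Heine _ _ c01 (fun t _ => f1 t) (mkposreal d d0).
have [d2 H2] := Heine _ _ c01 (fun t _ => f2 t) (mkposreal d d0).
have [[|n] [Hn n0]] := archimed_cor1 _ (Rmin_pos _ _ (cond_pos d1) (cond_pos d2)).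
  by move/leP: n0.
have N0 : (0 < INR n.+1)%R by apply: lt_0_INR; lia.
exists n; move NE : (INR n.+1) => N in N0 Hn *.
have -> : f 0%R = f (INR 0 / N)%R by rewrite /Rdiv Rmult_0_l.
suff main m k : m + k <= n.+1 ->
    path (near d) (f (INR m / N)%R) [seq f (INR i / N)%R | i <- iota m.+1 k].
  exact: main.
elim: k m => [//|k IH] m mk; rewrite -[iota m.+1 k.+1]/(m.+1 :: iota m.+2 k).
rewrite map_cons; apply/andP; split; last by apply: IH; lia.
have in01 i : i <= n.+1 -> (0 <= INR i / N <= 1)%R.
  by rewrite -NE; apply: sample_parameter_bounds.
have dm : (Rabs (INR m / N - INR m.+1 / N) < Rmin d1 d2)%R.
  have -> : (INR m / N - INR m.+1 / N = - / N)%R.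
    by rewrite (S_INR m); field; lra.
  by rewrite Rabs_Ropp Rabs_right //; apply/Rle_ge/Rlt_le/Rinv_0_lt_compat.
apply/andP; split; apply/RltbP.
  by apply: H1; [apply: in01; lia | apply: in01; lia | apply: Rlt_le_trans dm (Rmin_l _ _)].
by apply: H2; [apply: in01; lia | apply: in01; lia | apply: Rlt_le_trans dm (Rmin_r _ _)].
Qed.

Lemma far_le d d' p q : far d p q -> (0 < d' <= d)%R -> far d' p q.
Proof.
by move=> /orP[]/RltbP H ?; apply/orP; [left|right]; apply/RltbP; lra.
Qed.

(** First [d] is fixed as a common separation of all disjoint pairs of arcs; only then is each arc
    sampled with mesh [d]. *)
Lemma planar_drawable (T : finType) (e : rel T) : planar e -> drawable e.
Proof.
move=> [pos [arc [pos_inj [Harc Hdis]]]].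
have cont x y : e x y -> continuous_path (arc x y) by case/Harc.
have inner t : (0 <= t <= 1)%R -> [\/ t = 0%R, t = 1%R | (0 < t < 1)%R].
  move=> H; case: (Req_dec t 0) => [|?]; first by constructor 1.
  by case: (Req_dec t 1) => [|?]; [constructor 2 | constructor 3; lra].
(* Here the ends are included: vertices are distinct points and interiors avoid them. *)
have disj x y z w t s : e x y -> e z w -> uniq [:: x; y; z; w] ->
    (0 <= t <= 1)%R -> (0 <= s <= 1)%R -> arc x y t <> arc z w s.
  move=> xy zw; have [a0 a1 _ _ av] := Harc x y xy; have [b0 b1 _ _ bv] := Harc z w zw.
  rewrite /= !inE !negb_or -!andbA.
  case/and5P=> _ /eqP xz /eqP xw /eqP yz /and3P[/eqP yw _ _].
  case/inner=> [->|->|t1]; case/inner=> [->|->|s1];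
    rewrite ?a0 ?a1 ?b0 ?b1; do ?[by move/pos_inj | exact: av | by move/esym; apply: bv].
  by apply: Hdis => // -[[? ?]|[? ?]]; congruence.
pose P (q : T * T * T * T) d := e q.1.1.1 q.1.1.2 -> e q.1.2 q.2 ->
  uniq [:: q.1.1.1; q.1.1.2; q.1.2; q.2] ->
  forall t s, (0 <= t <= 1)%R -> (0 <= s <= 1)%R ->
    far d (arc q.1.1.1 q.1.1.2 t) (arc q.1.2 q.2 s).
have [d d0 Hd] : exists2 d, (0 < d)%R & forall q, P q d.
  apply: finite_common_bound => [q d d' H dd xy zw u t s t1 s1|[[[x y] z] w]].
    exact: far_le (H xy zw u t s t1 s1) dd.
  rewrite /P /=; case: (boolP [&& e x y, e z w & uniq [:: x; y; z; w]]); last first.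
    by move=> H; exists 1%R => [|xy zw u]; [lra | case/negP: H; apply/and3P].
  case/and3P=> xy zw u.
  have [||t s t1 s1|d d0 Hd] := @disjoint_paths_separated (arc x y) (arc z w).
  - exact: cont. 
  - exact: cont.
  - exact: disj.
  by exists d.
have [n Hn] : exists n : T * T -> nat, forall p, e p.1 p.2 ->
    path (near d) (arc p.1 p.2 0%R)
      [seq arc p.1 p.2 (INR i / INR (n p).+1)%R | i <- iota 1 (n p).+1].
  apply: (@fin_all_exists _ (fun=> nat) (fun p n => e p.1 p.2 ->
    path (near d) (arc p.1 p.2 0%R)
      [seq arc p.1 p.2 (INR i / INR n.+1)%R | i <- iota 1 n.+1])) => -[x y] /=.
  case: (boolP (e x y)) => [xy|_]; last by exists 0.
  by have [n Hn] := path_sampling (cont x y xy) d0; exists n.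
pose g x y i := arc x y (INR i / INR (n (x, y)).+1)%R.
have g0 x y : e x y -> g x y 0 = pos x.
  by move=> xy; rewrite /g /Rdiv Rmult_0_l; case: (Harc _ _ xy).
have g1 x y : e x y -> g x y (n (x, y)).+1 = pos y.
  move=> xy; rewrite /g Rdiv_diag; first by case: (Harc _ _ xy).
  by apply: not_0_INR.
pose smp x y := [seq g x y i | i <- iota 1 (n (x, y)).+1].
have smpE x y : e x y -> pos x :: smp x y = [seq g x y i | i <- iota 0 (n (x, y)).+2].
  by move=> xy; rewrite -(g0 x y xy).
exists d, pos, smp; split=> // [x y xy|x y z w xy zw u].
  split; first by have := Hn (x, y) xy; case: (Harc _ _ xy) => ->.
  rewrite -(g0 x y xy) last_map (last_nth 0) size_iota.
  by rewrite -[0 :: _]/(iota 0 (n (x, y)).+2) nth_iota // g1.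
rewrite !smpE //.
have in01 m i : i \in iota 0 m.+2 -> (0 <= INR i / INR m.+1 <= 1)%R.
  by rewrite mem_iota add0n ltnS => /andP[_ ?]; apply: sample_parameter_bounds.
rewrite allrel_mapl allrel_mapr; apply/allrelP => i j /in01 i1 /in01 j1.
exact: (Hd (x, y, z, w)).
Qed.

(** * Edge bound for drawable graphs *)

Section EdgeCount.
Variable T : finType.
Implicit Types (e : rel T) (S : {set T}).

Definition nbrs e S x : {set T} := [set y in S | e x y].

(** For a simple graph, twice the number of edges induced on [S]; varying [S] removes vertices
    without changing the type. *)
Definition darts e S : nat := \sum_(x in S) #|nbrs e S x|.

Lemma darts_setD1 e S x : symmetric e -> irreflexive e -> x \in S ->
  darts e S = darts e (S :\ x) + 2 * #|nbrs e S x|.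
Proof.
move=> sym irr xS; rewrite /darts (big_setD1 x) //= mul2n -addnn addnA addnC; congr (_ + _).
rewrite (eq_bigr (fun y => #|nbrs e (S :\ x) y| + e x y)) => [|y]; last first.
  rewrite !inE => /andP[yx yS]; rewrite (cardsD1 x) !inE xS /= sym addnC.
  congr (#|pred_of_set _| + _).
  by apply/setP => z; rewrite !inE andbA.
rewrite big_split /=; congr (_ + _).
rewrite -sum1_card big_mkcond [RHS]big_mkcond /=; apply: eq_bigr => y _.
by rewrite !inE; case: eqVneq => [->|_] /=; rewrite ?irr ?andbF //;
  case: (y \in S); case: (e x y).
Qed.

Lemma eq_darts e e' S : {in S &, e =2 e'} -> darts e S = darts e' S.
Proof.
move=> ee'; apply: eq_bigr => x xS; congr #|pred_of_set _|.
by apply/setP => y; rewrite !inE; case: (boolP (y \in S)) => //= yS; rewrite ee'.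
Qed.

Lemma darts_even e S : symmetric e -> irreflexive e -> ~~ odd (darts e S).
Proof.
move=> sym irr; move: {2}#|S| (erefl #|S|) => n.
elim: n S => [|n IH] S cS.
  by rewrite /darts big1 // => x; rewrite (cards0_eq cS) inE.
have /card_gt0P[x xS] : 0 < #|S| by rewrite cS.
rewrite (darts_setD1 sym irr xS) oddD oddM addbF IH //.
by move: cS; rewrite (cardsD1 x) xS => -[].
Qed.

Lemma darts_le e S : irreflexive e -> darts e S <= #|S| * #|S|.-1.
Proof.
move=> irr; rewrite -sum_nat_const; apply: leq_sum => x xS.
rewrite (cardsD1 x S) xS; apply/subset_leq_card/subsetP => y.
by rewrite !inE => /andP[->]; case: eqP => // ->; rewrite irr.
Qed.

Definition delete_edge e x y : rel T := fun u v =>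
  [&& e u v, ~~ ((u == x) && (v == y)) & ~~ ((u == y) && (v == x))].

Lemma delete_edge_sym e x y : symmetric e -> symmetric (delete_edge e x y).
Proof.
move=> sym u v; rewrite /delete_edge sym; congr (_ && _).
by rewrite andbC (andbC (v == y)) (andbC (v == x)).
Qed.

Lemma delete_edge_irr e x y : irreflexive e -> irreflexive (delete_edge e x y).
Proof. by move=> irr u; rewrite /delete_edge irr. Qed.

Lemma darts_delete_edge e S x y : symmetric e -> irreflexive e ->
  x \in S -> y \in S -> e x y -> darts e S = darts (delete_edge e x y) S + 2.
Proof.
move=> sym irr xS yS xy.
have nxy : x != y by apply: contraTneq xy => ->; rewrite irr.
rewrite (darts_setD1 sym irr xS).
rewrite (darts_setD1 (delete_edge_sym x y sym) (delete_edge_irr x y irr) xS).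
rewrite -(@eq_darts e); last first.
  move=> u v; rewrite !inE /delete_edge => /andP[/negPf-> _] /andP[/negPf-> _].
  by rewrite !andbF andbT.
rewrite (cardsD1 y (nbrs e S x)) !inE yS xy.
have -> : nbrs (delete_edge e x y) S x = nbrs e S x :\ y; last by lia.
by apply/setP => z; rewrite !inE /delete_edge eqxx (negPf nxy) andbT /=;
  case: (z \in S); case: (e x z); case: (z == y).
Qed.

Lemma contract_sym e x y : symmetric e -> symmetric (contract e x y).
Proof.
move=> sym u v; rewrite /contract (sym v u) (sym y v) (sym y u).
by case: (u == y); case: (v == y) => //=; congr orb; rewrite orbC.
Qed.

Lemma contract_irr e x y : irreflexive e -> irreflexive (contract e x y).
Proof. by move=> irr u; rewrite /contract irr; case: (u == x); rewrite /= !andbF. Qed.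

(** Contraction loses the edge [x y] and, for each common neighbour, one of its two edges to [x] and
    [y]; each lost edge is two darts. *)
Lemma darts_contract e S x y : symmetric e -> irreflexive e ->
  x \in S -> y \in S -> e x y ->
  darts e S = darts (contract e x y) (S :\ y) + 2 + 2 * #|nbrs e S x :&: nbrs e S y|.
Proof.
move=> sym irr xS yS xy.
have nxy : x != y by apply: contraTneq xy => ->; rewrite irr.
have symc := contract_sym x y sym; have irrc := contract_irr x y irr.
rewrite (darts_setD1 sym irr yS) (darts_setD1 (x := x) (S := S :\ y) sym irr) ?inE ?nxy //.
rewrite (darts_setD1 (x := x) symc irrc) ?inE ?nxy //.
rewrite -(@eq_darts e); last first.
  move=> u v; rewrite !inE /contract => /and3P[/negPf-> -> _] /and3P[/negPf-> -> _] /=.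
  by rewrite orbF.
have -> : #|nbrs (contract e x y) (S :\ y) x| =
    #|nbrs e (S :\ y) x :|: (nbrs e S y :\ x)|.
  congr #|pred_of_set _|; apply/setP => z; rewrite !inE /contract nxy eqxx /=.
  case: (eqVneq z y) => [->|zy] /=; first by rewrite irr !andbF.
  case: (eqVneq z x) => [->|zx] /=; rewrite ?irr ?andbF //.
  by rewrite orbF -andb_orr.
have -> : #|nbrs e S x :&: nbrs e S y| = #|nbrs e (S :\ y) x :&: (nbrs e S y :\ x)|.
  congr #|pred_of_set _|; apply/setP => z; rewrite !inE.
  case: (eqVneq z y) => [->|zy] /=; first by rewrite irr !andbF.
  by case: (eqVneq z x) => [->|zx] /=; rewrite ?irr ?andbF.
have := cardsUI (nbrs e (S :\ y) x) (nbrs e S y :\ x).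
have : #|nbrs e S y| = (#|nbrs e S y :\ x|).+1 by rewrite (cardsD1 x) !inE xS sym xy.
lia.
Qed.

(** * K5 minors and the minimal counterexample *)

Lemma drawable_no_clique e a b c d f :
  symmetric e -> drawable e -> uniq [:: a; b; c; d; f] ->
  pairwise e [:: a; b; c; d; f] -> False.
Proof.
move=> sym De U P; apply: (@drawable_no_K5 _ e [tuple a; b; c; d; f] De U) => i j ij.
rewrite !(tnth_nth a) /=.
wlog lt_ij : i j ij / i < j.
  by move=> W; case: (ltngtP i j) ij => [lt|lt|/val_inj->] ij; rewrite ?eqxx // in ij *;
    [exact: W | rewrite sym; apply: W]; rewrite // eq_sym.
by move/(pairwiseP a): P => P; apply: P => //; apply: ltn_ord.
Qed.

(** Each vertex of the neighbourhood [N] misses at most one other vertex of [N]. If [N] is complete,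
    [x] and four of its vertices form a K5. Otherwise [N] is a nonadjacent pair [a], [b] with three
    vertices [c], [d], [f] joined to both. *)
Lemma drawable_sparse_nbrs e S x : symmetric e -> irreflexive e -> drawable e ->
  x \in S -> 0 < #|nbrs e S x| <= 5 ->
  (forall y, y \in nbrs e S x -> 3 <= #|nbrs e S x :&: nbrs e S y|) -> False.
Proof.
move=> sym irr De xS /andP[N0 N5] N3.
set N := nbrs e S x in N0 N5 N3 *.
(* The set [A] may contain [y] itself, which is not its own neighbour. *)
have nonadj y (A : {set T}) : y \in N -> A \subset N ->
    (forall z, z \in A -> ~~ e y z) -> #|A| + 3 <= #|N|.
  move=> yN AN Ay; rewrite -(cardsID (nbrs e S y) N) addnC leq_add ?N3 //.
  apply/subset_leq_card/subsetP => z zA; rewrite in_setD (subsetP AN) // andbT.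
  by rewrite inE (negPf (Ay z zA)) andbF.
have NE y : y \in N -> e x y by rewrite inE => /andP[].
have xN y : y \in N -> x != y by move/NE; apply: contraTneq => <-; rewrite irr.
have N4 : 4 <= #|N|.
  have /card_gt0P[y yN] := N0.
  have := @nonadj y [set y] yN; rewrite sub1set cards1; apply=> // z.
  by rewrite inE => /eqP->; rewrite irr.
have [/existsP[a /existsP[b /and4P[aN bN nab ab]]]|] :=
    boolP [exists a, exists b, [&& a \in N, b \in N, a != b & ~~ e a b]]; last first.
  rewrite negb_exists => /forallP H.
  have cl a b : a \in N -> b \in N -> a != b -> e a b.
    move=> aN bN nab; have := H a; rewrite negb_exists => /forallP/(_ b).
    by rewrite aN bN nab negbK.
  have := mem_enum N; have := enum_uniq N; move: N4; rewrite cardE.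
  case: (enum N) => [|a [|b [|c [|d s]]]] //= _ U Nmem.
  have [aN bN cN dN] : [/\ a \in N, b \in N, c \in N & d \in N].
    by rewrite -!Nmem !inE !eqxx !orbT.
  move: U; rewrite !inE !negb_or -!andbA.
  case/and5P=> nab nac nad _ /and5P[nbc nbd _ ncd _].
  by apply: (@drawable_no_clique e x a b c d) => //=;
    rewrite ?inE ?negb_or ?NE ?xN ?cl ?nab ?nac ?nad ?nbc ?nbd ?ncd.
(* Two missed vertices together with [y] would force six vertices in [N]. *)
have two y z w : y \in N -> z \in N -> w \in N -> y != z -> y != w -> z != w ->
    ~~ e y z -> e y w.
  move=> yN zN wN yz yw zw nyz; apply: contraT => nyw.
  have := @nonadj y [set y; z; w] yN.
  rewrite !subUset !sub1set yN zN wN setUC cardsU1 !inE cards2 yz.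
  rewrite (eq_sym w y) (eq_sym w z) (negPf yw) (negPf zw) /= => /(_ isT).
  move=> H; suff : 3 + 3 <= #|N| by lia.
  by apply: H => u; rewrite !inE => /orP[|/orP[]] /eqP-> //; rewrite irr.
have cM : #|N :\ a :\ b| = 3.
  have := @nonadj a [set a; b] aN; rewrite subUset !sub1set aN bN cards2 nab => /(_ isT) H.
  have {H} : 2 + 3 <= #|N|.
    by apply: H => z; rewrite !inE => /orP[]/eqP-> //; rewrite irr.
  have : #|N| = #|N :\ a :\ b| + 2; last by lia.
  by rewrite (cardsD1 a N) aN (cardsD1 b (N :\ a)) in_setD1 eq_sym nab bN; lia.
have := mem_enum (N :\ a :\ b); have := enum_uniq (N :\ a :\ b); move: cM; rewrite cardE.
case: (enum (N :\ a :\ b)) => [|c [|d [|f []]]] //= _ U Mmem.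
have HM z : z \in [:: c; d; f] -> [/\ z \in N, e a z, e b z, a != z & b != z].
  rewrite Mmem !in_setD1 => /and3P[zb za zN]; split; rewrite 1?eq_sym //.
    by apply: (two a b z); rewrite // eq_sym.
  by apply: (two b a z); rewrite 1?sym // eq_sym.
move: U; rewrite !inE !negb_or !andbT => /andP[/andP[ncd ncf] ndf].
have [cN ac bc nac nbc] := HM c (mem_head _ _).
have [dN ad bd nad nbd] : [/\ d \in N, e a d, e b d, a != d & b != d].
  by apply: HM; rewrite !inE eqxx orbT.
have [fN af bf naf nbf] : [/\ f \in N, e a f, e b f, a != f & b != f].
  by apply: HM; rewrite !inE eqxx !orbT.
(* If [u] and [v] are not adjacent then [a u b v] is a 4-cycle joined to both
   [x] and [w]; contracting [a u] gives a K5. *)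
have wheel u v w : u \in N -> v \in N -> w \in N -> u != v -> u != w -> v != w ->
    a != u -> a != v -> a != w -> b != u -> b != v -> b != w ->
    e a u -> e a v -> e a w -> e b u -> e b v -> e b w -> ~~ e u v -> False.
  move=> uN vN wN nuv nuw nvw nau nav naw nbu nbv nbw au av aw bu bv bw uv.
  have uw := two u v w uN vN wN nuv nuw nvw uv.
  have vw : e v w by apply: (two v u w); rewrite // 1?sym // eq_sym.
  apply: (@drawable_no_clique (contract e a u) x w a b v).
  - exact: contract_sym.
  - exact: contract_drawable.
  - by rewrite /= !inE !negb_or !xN // nab nav nbv !(eq_sym w) naw nbw nvw.
  have ce p q : p != u -> q != u -> e p q -> contract e a u p q.
    by rewrite /contract => -> -> ->.
  have ab' : contract e a u a b.
    by rewrite /contract nau nbu eqxx (eq_sym b a) nab (sym u b) bu /= orbT.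
  by rewrite /= ab' !ce ?NE ?xN //; rewrite // 1?sym // eq_sym.
case: (boolP (e c d)) => [cd|]; last exact: (wheel c d f).
case: (boolP (e c f)) => [cf|]; last by apply: (wheel c f d); rewrite // eq_sym.
case: (boolP (e d f)) => [df|]; last by apply: (wheel d f c); rewrite // eq_sym.
by apply: (@drawable_no_clique e x a c d f) => //=;
    rewrite ?inE ?negb_or ?NE ?xN ?nac ?nad ?naf ?ncd ?ncf ?ndf ?ac ?ad ?af ?cd ?cf ?df.
Qed.

(** The measure, darts plus vertices, drops under contraction, edge deletion and removal of an
    isolated vertex. *)
Lemma darts_drawable e S : symmetric e -> irreflexive e -> drawable e ->
  3 <= #|S| -> darts e S + 12 <= 6 * #|S|.
Proof.
move: {2}(darts e S + #|S|).+1 (ltnSn (darts e S + #|S|)) => n.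
elim: n e S => // n IH e S Hn sym irr De S3; rewrite leqNgt; apply/negP => bad.
have ev := darts_even S sym irr.
(* Three vertices carry at most 6 = 6 * 3 - 12 darts; from four on, a vertex can be removed within
   the range of the induction. *)
have S4 : 3 < #|S|.
  rewrite ltn_neqAle S3 andbT; apply/eqP => E3.
  by have := darts_le S irr; rewrite -E3 in bad *; move: bad; lia.
have cD y : y \in S -> #|S| = #|S :\ y|.+1 by move=> yS; rewrite (cardsD1 y) yS.
(* With at most two common neighbours, contraction would lose at most six darts, no more than the
   bound loses with a vertex. *)
have common x y : x \in S -> y \in nbrs e S x -> 3 <= #|nbrs e S x :&: nbrs e S y|.
  rewrite inE => xS /andP[yS xy].
  have dE := darts_contract sym irr xS yS xy.
  have := IH (contract e x y) (S :\ y) _ (contract_sym x y sym)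
    (contract_irr x y irr) (contract_drawable sym irr xy De).
  by have := cD y yS; move: dE S4 Hn bad; lia.
(* If all degrees were at least six, deleting one edge would leave a smaller counterexample. *)
have [x xS deg5] : exists2 x, x \in S & #|nbrs e S x| <= 5.
  apply/exists_inP; apply: contraT; rewrite negb_exists_in => /forall_inP big.
  have big6 : 6 * #|S| <= darts e S.
    rewrite mulnC -sum_nat_const; apply: leq_sum => x xS; rewrite ltnNge; exact: big.
  have /card_gt0P[x xS] : 0 < #|S| by lia.
  have /card_gt0P[y] : 0 < #|nbrs e S x| by have := big x xS; rewrite -ltnNge; lia.
  rewrite inE => /andP[yS xy].
  have sub : subrel (delete_edge e x y) e by move=> u v /and3P[].
  have := IH (delete_edge e x y) S _ (delete_edge_sym x y sym)
    (delete_edge_irr x y irr) (sub_drawable sub De) S3.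
  by have := darts_delete_edge sym irr xS yS xy; lia.
have deg0 : 0 < #|nbrs e S x|.
  rewrite lt0n; apply/eqP => d0.
  have dE := darts_setD1 sym irr xS.
  have := IH e (S :\ x) _ sym irr De.
  by have := cD x xS; move: dE S4 Hn bad d0; lia.
by apply: (drawable_sparse_nbrs sym irr De xS) => [|y]; [rewrite deg0 | apply: common].
Qed.
End EdgeCount.

(** * Colours *)

Section Colours.
Variables (T : finType) (c : {set T} -> nat).
Implicit Types (e : rel T) (S : {set T}).

Definition colours e : seq nat := undup [seq c f | f <- enum (edges e)].

Lemma edgesP e f :
  reflect (exists x y, e x y /\ f = [set x; y]) (f \in edges e).
Proof.
rewrite inE; apply: (iffP existsP) => [[x /existsP[y /andP[xy /eqP->]]]|[x [y [xy ->]]]].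
  by exists x, y.
by exists x; apply/existsP; exists y; rewrite xy eqxx.
Qed.

Lemma coloursP e k :
  reflect (exists2 f, f \in edges e & c f = k) (k \in colours e).
Proof.
rewrite mem_undup; apply: (iffP mapP) => [[f fe ->]|[f fe <-]]; exists f => //.
  by move: fe; rewrite mem_enum.
by rewrite mem_enum.
Qed.

Definition filter_edges e (P : pred nat) : rel T :=
  fun x y => e x y && P (c [set x; y]).

Lemma mem_filter_edges e P f :
  (f \in edges (filter_edges e P)) = (f \in edges e) && P (c f).
Proof.
apply/edgesP/andP => [[x [y [/andP[xy Pxy] ->]]]|[/edgesP[x [y [xy ->]]] Pxy]].
  by split=> //; apply/edgesP; exists x, y.
by exists x, y; rewrite /filter_edges xy.
Qed.

Lemma filter_edges_simple e P : simple_graph e -> simple_graph (filter_edges e P).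
Proof.
move=> [sym irr]; split=> [x y|x]; last by rewrite /filter_edges irr.
by rewrite /filter_edges sym setUC.
Qed.

Lemma size_colours_filter_edges e P :
  size (colours (filter_edges e P)) = count P (colours e).
Proof.
rewrite -size_filter; apply/perm_size/uniq_perm.
- exact: undup_uniq.
- exact/filter_uniq/undup_uniq.
move=> k; rewrite mem_filter; apply/coloursP/andP.
  case=> f; rewrite mem_filter_edges => /andP[fe Pf] <-; split=> //.
  by apply/coloursP; exists f.
by case=> Pk /coloursP[f fe E]; exists f => //; rewrite mem_filter_edges fe E.
Qed.

Lemma filter_edges_interval e (P : pred nat) :
  (forall i j k, P i -> P j -> i <= k <= j -> P k) ->
  interval_colouring e c -> interval_colouring (filter_edges e P) c.
Proof.
move=> convP [prop int]; split=> [f1 f2|v a b k].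
  by rewrite !mem_filter_edges => /andP[f1e _] /andP[f2e _]; apply: prop.
case=> f1; rewrite mem_filter_edges => /andP[f1e Pf1] /andP[vf1 /eqP c1].
case=> f2; rewrite mem_filter_edges => /andP[f2e Pf2] /andP[vf2 /eqP c2] akb.
have [||f fe /andP[vf /eqP cf]] := int v a b k _ _ akb.
- by exists f1; rewrite // vf1 c1 eqxx.
- by exists f2; rewrite // vf2 c2 eqxx.
exists f; last by rewrite vf cf eqxx.
by rewrite mem_filter_edges fe cf; apply: convP akb; rewrite -?c1 -?c2.
Qed.

(** Symmetry of [e] puts the other end in [S] too; [S] may also hold isolated vertices. *)
Definition spanned e S := forall x y, e x y -> x \in S.

Lemma edges_darts e S : simple_graph e -> spanned e S ->
  2 * #|edges e| <= darts e S.
Proof.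
move=> [sym irr] span.
have -> : 2 * #|edges e| = \sum_(f in edges e) #|f|.
  rewrite mulnC -sum_nat_const; apply: eq_bigr => f /edgesP[x [y [xy ->]]].
  by rewrite cards2; case: eqVneq xy => [->|]; rewrite ?irr.
have fE f : f \in edges e -> #|f| = \sum_(x in S) (if x \in f then 1 else 0).
  move=> fe; rewrite -big_mkcondr sum1_card; apply: eq_card => z.
  rewrite [RHS]unfold_in /=; case: (boolP (z \in f)) => zf; rewrite ?andbT ?andbF //.
  move: zf; have /edgesP[x [y [xy ->]]] := fe; rewrite !inE => /orP[]/eqP->.
    by rewrite (span x y).
  by rewrite (span y x) // sym.
rewrite (eq_bigr _ fE) exchange_big; apply: leq_sum => x xS /=.
rewrite -big_mkcondr sum1_card.
apply: leq_trans (leq_imset_card (fun y => [set x; y]) _).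
apply/subset_leq_card/subsetP => f; rewrite unfold_in => /andP[/edgesP[a [b [ab ->]]]].
rewrite in_set2 => /orP[]/eqP->; apply/imsetP.
  by exists b; rewrite // inE ab (span b a) // sym.
by exists a; rewrite 1?setUC // inE sym ab (span a b).
Qed.

Lemma colour_used_once e k : 
  k \in colours e -> #|[set f in edges e | c f == k]| < 2 ->
  exists x y, e x y /\ forall f, f \in edges e -> c f = k -> f = [set x; y].
Proof.
case/coloursP=> f0 f0e f0k le; have /edgesP[x [y [xy E]]] := f0e.
exists x, y; split=> // f fe fk.
have /card_le1P H : #|[set f in edges e | c f == k]| <= 1 by [].
have f0A : f0 \in [set f in edges e | c f == k] by rewrite inE f0e f0k eqxx.
have fA : f \in [set f in edges e | c f == k] by rewrite inE fe fk eqxx.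
by have := H f0 f0A f; rewrite fA -E => /esym/eqP.
Qed.

(** Edges are counted by colour: every colour contributes at least one, and all but the two extreme
    ones at least two. *)
Lemma colours_le_edges e :
  (forall k i j, k \in colours e -> i \in colours e -> j \in colours e ->
     i < k < j -> 2 <= #|[set f in edges e | c f == k]|) ->
  2 * size (colours e) <= #|edges e| + 2.
Proof.
move=> twice; set s := colours e.
pose once k := #|[set f in edges e | c f == k]| < 2.
have us : uniq s := undup_uniq _.
have sumE : #|edges e| = \sum_(k <- s) #|[set f in edges e | c f == k]|.
  rewrite -sum1_card.
  rewrite (eq_bigr (fun f => \sum_(k <- s) (if c f == k then 1 else 0))) => [|f fe].
    rewrite exchange_big; apply: eq_bigr => k _ /=; rewrite -big_mkcondr sum1_card.
    by apply: eq_card => f; rewrite [RHS]inE.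
  have fs : c f \in s by apply/coloursP; exists f.
  by rewrite (bigD1_seq (c f)) //= eqxx big1 // => k; rewrite eq_sym => /negPf->.
have sum_ge : 2 * size s <= \sum_(k <- s) #|[set f in edges e | c f == k]| + count once s.
  rewrite -sum1_count [X in _ + X]big_mkcond -big_split /= mulnC -sum1_size big_distrl /=.
  rewrite big_seq [leqRHS]big_seq; apply: leq_sum => k ks.
  rewrite mul1n; case: ifP => [_|/negbT]; last by rewrite /once -leqNgt addn0.
  rewrite addn1 ltnS card_gt0; apply/set0Pn.
  by have /coloursP[f fe fk] := ks; exists f; rewrite inE fe fk eqxx.
suff : count once s <= 2 by lia.
rewrite -size_filter.
set o := [seq k <- s | once k].
have so := sort_sorted leq_total o; have uo : uniq (sort leq o).
  by rewrite sort_uniq filter_uniq.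
rewrite -(size_sort leq); have := mem_sort leq o.
(* Among three colours used once, the second in sorted order would contradict [twice]. *)
case: (sort leq o) so uo => [|i [|k [|j r]]] //= /and3P[ik kj _] U omem.
have [iS kS jS] : [/\ i \in o, k \in o & j \in o].
  by rewrite -!omem !inE !eqxx !orbT.
move: U; rewrite !inE !negb_or -!andbA => /and5P[nik _ _ nkj _].
move: iS kS jS; rewrite !mem_filter => /andP[_ iS] /andP[ok kS] /andP[_ jS].
have ikj : i < k < j by lia.
by move: ok; rewrite /once ltnNge (twice k i j).
Qed.

(** Induction on the number of colours. Splitting at [k] repeats two vertices and one colour, and
    the two bounds add up exactly because 3 * 2 = 2 * 1 + 4. *)
Lemma colours_drawable e S : simple_graph e -> drawable e -> spanned e S ->
  2 <= #|S| -> interval_colouring e c -> 2 * size (colours e) + 4 <= 3 * #|S|.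
Proof.
move: {2}(size (colours e)).+1 (ltnSn (size (colours e))) => n.
elim: n e S => // n IH e S Hn simp De span S2 col.
have [sym irr] := simp.
case: (boolP (has (fun k => [&& #|[set f in edges e | c f == k]| < 2,
    has (gtn k) (colours e) & has (ltn k) (colours e)]) (colours e))); last first.
  move/hasPn => H.
  have /colours_le_edges le : forall k i j, k \in colours e -> i \in colours e ->
      j \in colours e -> i < k < j -> 2 <= #|[set f in edges e | c f == k]|.
    move=> k i j ks iS jS /andP[ik kj]; rewrite leqNgt; apply/negP => lt.
    case/negP: (H k ks); apply/and3P; split=> //; apply/hasP; by [exists i | exists j].
  have leE := edges_darts simp span.
  have [S3|] := leqP 3 #|S|.
    by have := darts_drawable sym irr De S3; lia.
  (* On two vertices there is at most one edge, hence one colour, and the bound reads 2 + 4 <= 6. *)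
  have leC : size (colours e) <= #|edges e|.
    by rewrite cardE; apply: leq_trans (size_undup _) _; rewrite size_map.
  move=> S2'; have E2 : #|S| = 2 by lia.
  by have := darts_le S irr; rewrite E2; lia.
case/hasP=> k ks /and3P[once /hasP[i iS ik] /hasP[j jS kj]].
have [u [v [uv uniq_k]]] := colour_used_once ks once.
have [prop int] := col.
pose e1 := filter_edges e (geq k); pose e2 := filter_edges e (leq k).
pose S1 := [set x in S | [exists y, e1 x y]].
have cuv : c [set u; v] = k by have /coloursP[f fe fk] := ks; rewrite -(uniq_k f fe fk).
have nuv : u != v by apply: contraTneq uv => ->; rewrite irr.
have uvS1 : [set u; v] \subset S1.
  rewrite subUset !sub1set !inE (span u v uv) (span v u) /= 1?sym //.
  apply/andP; split; apply/existsP; [exists v | exists u].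
    by rewrite /e1 /filter_edges uv /= cuv.
  by rewrite /e1 /filter_edges sym uv /= setUC cuv.
(* Vertices meeting no colour up to [k], isolated ones included, form the second part, to which [u]
   and [v] are added. *)
pose S2' := (S :\: S1) :|: [set u; v].
have cS : #|S1| + #|S2'| = #|S| + 2.
  have dis : (S :\: S1) :&: [set u; v] = set0.
    apply/setP => x; rewrite in_setI in_setD in_set0.
    case: (boolP (x \in [set u; v])); rewrite ?andbF //.
    by move/(subsetP uvS1) => ->.
  have S1S : S :&: S1 = S1 by apply/setIidPr/subsetP => x; rewrite inE => /andP[].
  by rewrite cardsU dis cards0 cards2 nuv -(cardsID S1 S) S1S; lia.
have span1 : spanned e1 S1.
  move=> x y xy; rewrite inE; apply/andP; split; last by apply/existsP; exists y.
  by case/andP: xy => /span.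
have span2 : spanned e2 S2'.
  move=> x y /andP[xy ky]; rewrite in_setU in_setD (span x y xy) andbT.
  case: (boolP (x \in S1)) => //=; rewrite inE => /andP[_ /existsP[z /andP[xz zk]]].
  (* The colours of [x z] and [x y] lie on both sides of [k], so [x] meets colour [k] and is an end
     of [u v]. *)
  have [|||f fe /andP[xf /eqP fk]] := int x (c [set x; z]) (c [set x; y]) k.
  - exists [set x; z]; last by rewrite !inE !eqxx.
    by apply/edgesP; exists x, z.
  - exists [set x; y]; last by rewrite !inE !eqxx.
    by apply/edgesP; exists x, y.
  - by move: zk => /= ->.
  by rewrite -(uniq_k f fe fk).
have size12 : size (colours e1) + size (colours e2) = size (colours e) + 1.
  rewrite !size_colours_filter_edges -count_predUI.
  rewrite (eq_count (a2 := predT)) ?count_predT; last by move=> x /=; lia.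
  rewrite (eq_count (a2 := pred1 k)); last by move=> x /=; lia.
  by rewrite count_uniq_mem ?undup_uniq // ks.
(* The colour [j] is absent from [e1] and [i] from [e2], so the induction hypothesis covers both
   parts. *)
have lt1 : size (colours e1) < size (colours e).
  rewrite size_colours_filter_edges -(count_predC (geq k)) -[ltnLHS]addn0 ltn_add2l.
  by rewrite -has_count; apply/hasP; exists j => //=; rewrite -ltnNge.
have lt2 : size (colours e2) < size (colours e).
  rewrite size_colours_filter_edges -(count_predC (leq k)) -[ltnLHS]addn0 ltn_add2l.
  by rewrite -has_count; apply/hasP; exists i => //=; rewrite -ltnNge.
have sub P : subrel (filter_edges e P) e by move=> x y /andP[].
have c2 : 2 <= #|[set u; v]| by rewrite cards2 nuv.
have := IH e1 S1 _ (filter_edges_simple _ simp) (sub_drawable (sub _) De) span1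
  (leq_trans c2 (subset_leq_card uvS1)) (filter_edges_interval _ col).
have := IH e2 S2' _ (filter_edges_simple _ simp) (sub_drawable (sub _) De) span2
  (leq_trans c2 (subset_leq_card (subsetUr _ _))) (filter_edges_interval _ col).
move=> H2 H1; have {}H2 := H2 ltac:(lia) ltac:(by move=> /= *; lia).
have {}H1 := H1 ltac:(lia) ltac:(by move=> /= *; lia).
lia.
Qed.
End Colours.

(* t(G) <= 3n/2 - 2, written over nat as 2 * (#colours) + 4 <= 3 n. *)
Theorem theorem3 (T : finType) (e : rel T) (c : {set T} -> nat) :
  simple_graph e -> planar e -> 2 <= #|T| ->
  interval_colouring e c ->
  2 * num_colours e c + 4 <= 3 * #|T|.
Proof.
move=> simp /planar_drawable De T2; rewrite -cardsT in T2 *.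
by apply: colours_drawable => // x y _; rewrite inE.
Qed.
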